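(* Let $S_3=\{(3,0,-2,0),(1,-1,-2,1),(2,-1,-2,0)\}$. If $(t_1,t_2,t_3,t_4)\in S_3$, then for all integers $n\geq 0$, $$a_{1^{t_1}2^{t_2}3^{t_3}4^{t_4}}(3n)>0,\qquad a_{1^{t_1}2^{t_2}3^{t_3}4^{t_4}}(3n+1)<0,\qquad a_{1^{t_1}2^{t_2}3^{t_3}4^{t_4}}(3n+2)=0.$$
   Context: For $|q|<1$ (or as formal power series in $q$) let $f_j:=(q^j;q^j)_\infty=\prod_{k\ge 1}(1-q^{jk})$ for each positive integer $j$. For a positive integer $m$ and integers $t_1,\dots,t_m$ (possibly zero or negative), the integers $a_{1^{t_1}2^{t_2}\cdots m^{t_m}}(n)$, $n\ge 0$, are defined by $\sum_{n=0}^\infty a_{1^{t_1}2^{t_2}\cdots m^{t_m}}(n)q^n=f_1^{t_1}f_2^{t_2}\cdots f_m^{t_m}$. Factors with exponent $0$ may be omitted from the notation. *)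

(* Defs.v *)
From HB Require Import structures.
From mathcomp Require Import all_boot all_order all_algebra.
From mathcomp Require Import boolp.

Set Implicit Arguments.
Unset Strict Implicit.
Unset Printing Implicit Defensive.

Import Order.TTheory GRing.Theory Num.Theory.
Local Open Scope ring_scope.

(* Formal power series over int.  The record wrapper keeps them apart from    *)
(* plain functions, whose ring structure elsewhere is the pointwise one.      *)
Record fps := Fps { fcoef : nat -> int }.

Lemma fpsP (f g : fps) : fcoef f =1 fcoef g -> f = g.
Proof. by case: f g => [f] [g] /= /funext ->. Qed.

HB.instance Definition _ := gen_eqMixin fps.
HB.instance Definition _ := gen_choiceMixin fps.

Definition fps_zero := Fps (fun=> 0).
Definition fps_opp f := Fps (fun n => - fcoef f n).
Definition fps_add f g := Fps (fun n => fcoef f n + fcoef g n).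

Fact fps_addA : associative fps_add.
Proof. by move=> f g h; apply: fpsP => n /=; rewrite addrA. Qed.
Fact fps_addC : commutative fps_add.
Proof. by move=> f g; apply: fpsP => n /=; rewrite addrC. Qed.
Fact fps_add0 : left_id fps_zero fps_add.
Proof. by move=> f; apply: fpsP => n /=; rewrite add0r. Qed.
Fact fps_addN : left_inverse fps_zero fps_opp fps_add.
Proof. by move=> f; apply: fpsP => n /=; rewrite addNr. Qed.

HB.instance Definition _ :=
  GRing.isZmodule.Build fps fps_addA fps_addC fps_add0 fps_addN.

Definition fps_one := Fps (fun n => (n == 0%N)%:R).
Definition fps_mul f g :=
  Fps (fun n => \sum_(i < n.+1) fcoef f i * fcoef g (n - i)%N).

Definition fps_trunc N f : {poly int} := \poly_(i < N) fcoef f i.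

Lemma fps_mul_trunc N f g n : (n < N)%N ->
  fcoef (fps_mul f g) n = (fps_trunc N f * fps_trunc N g)`_n.
Proof.
move=> ltnN; rewrite coefM /=; apply: eq_bigr => i _; rewrite !coef_poly.
by rewrite (leq_trans (ltn_ord i)) // (leq_ltn_trans (leq_subr _ _)).
Qed.

Fact fps_mulC : commutative fps_mul.
Proof.
by move=> f g; apply: fpsP => n; rewrite !(@fps_mul_trunc n.+1) // mulrC.
Qed.

Fact fps_mulA : associative fps_mul.
Proof.
move=> f g h; apply: fpsP => n.
have -> : fcoef (fps_mul f (fps_mul g h)) n =
    (fps_trunc n.+1 f * (fps_trunc n.+1 g * fps_trunc n.+1 h))`_n.
  rewrite coefM; apply: eq_bigr => i _.
  by rewrite (@fps_mul_trunc n.+1) ?ltnS ?leq_subr // coef_poly ltn_ord.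
rewrite mulrA coefM; apply: eq_bigr => i _.
rewrite (@fps_mul_trunc n.+1) ?ltn_ord // [X in _ * X = _]coef_poly.
by rewrite ltnS leq_subr.
Qed.

Fact fps_mul1 : left_id fps_one fps_mul.
Proof.
move=> f; apply: fpsP => n /=; rewrite big_ord_recl subn0 mul1r big1 ?addr0 //.
by move=> i _; rewrite /= mul0r.
Qed.

Fact fps_mulDl : left_distributive fps_mul fps_add.
Proof.
move=> f g h; apply: fpsP => n /=; rewrite -big_split /=.
by apply: eq_bigr => i _; rewrite mulrDl.
Qed.

Fact fps_1neq0 : fps_one != 0.
Proof. by apply/eqP => /(congr1 (fcoef^~ 0%N)). Qed.

HB.instance Definition _ := GRing.Zmodule_isComNzRing.Build fps
  fps_mulA fps_mulC fps_mul1 fps_mulDl fps_1neq0.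

(* A series is a unit iff its constant term is; the coefficients g_0, ..., g_n *)
(* of its inverse are computed successively from                              *)
(*   f_0 g_n = - \sum_(i < n) f_(n - i) g_i.                                  *)
Definition fps_unit : pred fps := fun f => fcoef f 0 \is a GRing.unit.

Fixpoint fps_inv_seq (f : fps) n : seq int :=
  if n is n'.+1 then
    let s := fps_inv_seq f n' in
    rcons s (- (fcoef f 0)^-1 * \sum_(i < n) fcoef f (n - i)%N * s`_i)
  else [:: (fcoef f 0)^-1].

Definition fps_inv f :=
  if fps_unit f then Fps (fun n => (fps_inv_seq f n)`_n) else f.

Lemma size_fps_inv_seq f n : size (fps_inv_seq f n) = n.+1.
Proof. by elim: n => //= n IHn; rewrite size_rcons IHn. Qed.

Lemma nth_fps_inv_seq f n i : (i <= n)%N ->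
  (fps_inv_seq f n)`_i = (fps_inv_seq f i)`_i.
Proof.
elim: n => [|n IHn]; first by rewrite leqn0 => /eqP->.
rewrite leq_eqVlt => /predU1P[-> //|ltin].
by rewrite /= nth_rcons size_fps_inv_seq ltin IHn.
Qed.

Fact fps_mulVr : {in fps_unit, left_inverse 1 fps_inv *%R}.
Proof.
move=> f Uf; rewrite [LHS]mulrC; apply: fpsP => n.
have Uf0 : fcoef f 0 \is a GRing.unit by [].
rewrite /fps_inv [fps_unit f]Uf /=; case: n => [|n].
  by rewrite big_ord_recl big_ord0 addr0 /= divrr.
rewrite big_ord_recl subn0 [nth _ _ _]/= nth_rcons size_fps_inv_seq ltnn eqxx.
rewrite mulrA mulrN divrr // mulN1r; apply/eqP; rewrite addrC subr_eq0; apply/eqP.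
rewrite (reindex_inj rev_ord_inj); apply: eq_bigr => i _ /=.
have lein : (i <= n)%N by rewrite -ltnS.
rewrite /bump /= add1n !subSS subKn // [in RHS]nth_fps_inv_seq //.
by rewrite subSn.
Qed.

Fact fps_unitPl f g : g * f = 1 -> fps_unit f.
Proof.
move=> /(congr1 (fcoef^~ 0%N)) /=; rewrite big_ord_recl big_ord0 addr0 subnn => gf1.
by rewrite /fps_unit; apply/unitrPr; exists (fcoef g 0); rewrite mulrC.
Qed.

Fact fps_inv_out : {in [predC fps_unit], fps_inv =1 id}.
Proof. by move=> f /negPf; rewrite /fps_inv => U; rewrite [fps_unit f]U. Qed.

HB.instance Definition _ := GRing.ComNzRing_hasMulInverse.Build fps
  fps_mulVr fps_unitPl fps_inv_out.

(* f_j = \prod_(k >= 1) (1 - q^(j k)).  For j >= 1 the factors with k > n do   *)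
(* not affect the coefficient of q^n: see fcoef_eulerE.                       *)
Definition euler (j : nat) : fps :=
  Fps (fun n => (\prod_(1 <= k < n.+1) (1 - 'X^(j * k)) : {poly int})`_n).

Lemma fcoef_eulerE j n N : (0 < j)%N -> (n <= N)%N ->
  fcoef (euler j) n = (\prod_(1 <= k < N.+1) (1 - 'X^(j * k)) : {poly int})`_n.
Proof.
move=> j_gt0; elim: N => [|N IHN]; first by rewrite leqn0 => /eqP->.
rewrite leq_eqVlt => /predU1P[-> //|ltnN].
rewrite (IHN ltnN) [in RHS]big_nat_recr //= mulrBr mulr1 coefB coefMXn.
by rewrite (leq_trans ltnN) ?leq_pmull // subr0.
Qed.

(* Makes the negative powers of f_j genuine inverses.                         *)
Lemma euler_unit j : euler j \is a GRing.unit.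
Proof.
by rewrite [_ \is a _]/(fps_unit _) /fps_unit /= big_geq // coef1.
Qed.

(* a_{1^{t_1} ... m^{t_m}}(n), with t = [:: t_1; ...; t_m].                   *)
Definition euler_quot_coef (t : seq int) (n : nat) : int :=
  fcoef (\prod_(i < size t) euler i.+1 ^ t`_i) n.

Definition S3 : seq (int * int * int * int) :=
  [:: (3, 0, -2, 0); (1, -1, -2, 1); (2, -1, -2, 0)].

(* Main.v *)
Require Import Defs.
From mathcomp Require Import all_boot all_order all_algebra.
From mathcomp Require Import zify ring.

(* The Jacobi triple product writes f_1^2 / f_2, 2 f_1 f_4 / f_2 and f_1^3 as *)
(* theta series sum_k w(k) a^(k(k+1)/2) b^(k(k-1)/2) with (a, b) equal to     *)
(* (-q, -q), (-q, 1) and (-q, -1), and w(k) = 1, 1 and k; weighting by k      *)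
(* amounts to applying to both sides the derivation a d/da - b d/db.  The     *)
(* exponents of q that occur are all 0 or 1 mod 3, and splitting k mod 3 turns *)
(* each series into A - q B with A and B again theta series, now in x = q^3.  *)
(* Dividing by f_3^2, that is by the square of f_1 taken at x, and expanding  *)
(* A and B by the triple product leaves products of factors 1 / (1 - x^k) and *)
(* 1 + x^k, with 1 / (1 - x) among them.  Only f_1^3 / f_3^2 needs more: there *)
(* the first part is (1 + 6 L) / f_1 with                                     *)
(*   L = sum_j x^(3j+1) (1 - x) / ((1 - x^(3j+1)) (1 - x^(3j+2))),            *)
(* where the factor 1 - x cancels against 1 / f_1, and the second is          *)
(* 3 f_3^3 / f_1^2, whose numerators are absorbed in pairs of denominators by *)
(*   (1 - X Y) / ((1 - X) (1 - Y)) = 1 / (1 - Y) + X / (1 - X).               *)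

Import Order.TTheory GRing.Theory Num.Theory.
Local Open Scope ring_scope.

Implicit Types (f g h a b Q z : fps) (N n m j : nat) (k : int).

(** * Congruences of power series *)

(** Each quotient is F / f_3^2, where F, doubled in the case of f_1 f_4 / f_2, is a theta series
    whose exponents are 0 or 1 mod 3. So F / f_3^2 = A - q B with A and B series in q^3, and the
    claim says that all coefficients of A and B, as series in q^3, are positive ([sign_pattern]).
    The pairs A, B come from [phi_split], [psi_split] and [cube_split].

    No infinite sum or product is formed: everything is a congruence modulo q^N between finite ones.
    [triple_product] and [triple_product_deriv] follow from exact identities with Gaussian
    binomials, [finite_triple_product] and its derivative; [theta_dissection] and
    [dtheta_dissection] split sums mod 3. Positivity is read off factor by factor: one factor 1 / (1
    - q^3) makes every coefficient positive, and factors with nonnegative coefficients and constant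
    term 1 preserve this ([pos3M]). *)

Definition fps_q : fps := Fps (fun i => (i == 1)%:R).
Local Notation q := fps_q.

Lemma fcoefD f g i : fcoef (f + g) i = fcoef f i + fcoef g i.
Proof. by []. Qed.

Lemma fcoefN f i : fcoef (- f) i = - fcoef f i.
Proof. by []. Qed.

Lemma fcoefB f g i : fcoef (f - g) i = fcoef f i - fcoef g i.
Proof. by []. Qed.

Lemma fcoefM f g n : fcoef (f * g) n = \sum_(i < n.+1) fcoef f i * fcoef g (n - i)%N.
Proof. by []. Qed.

Lemma fcoef1 i : fcoef 1 i = (i == 0)%:R.
Proof. by []. Qed.

Lemma fcoefMn f n i : fcoef (f *+ n) i = fcoef f i *+ n.
Proof. by elim: n => [|n IHn]; rewrite ?mulr0n // !mulrS fcoefD IHn. Qed.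

Lemma fcoef_sum (I : finType) (F : I -> fps) i :
  fcoef (\sum_j F j) i = \sum_j fcoef (F j) i.
Proof. by apply: (big_morph (fcoef^~ i)). Qed.

Lemma fcoefM0 f g : fcoef (f * g) 0 = fcoef f 0 * fcoef g 0.
Proof. by rewrite fcoefM big_ord_recl big_ord0 addr0. Qed.

Lemma fcoef_qM f i : fcoef (q * f) i = if i is i'.+1 then fcoef f i' else 0.
Proof.
case: i => [|i]; first by rewrite fcoefM0 mul0r.
rewrite fcoefM 2!big_ord_recl /= mul0r add0r mul1r subSS subn0 big1 ?addr0 //.
by move=> j _; rewrite mul0r.
Qed.

Lemma fcoef_qnM n f i :
  fcoef (q ^+ n * f) i = if (n <= i)%N then fcoef f (i - n)%N else 0.
Proof.
elim: n i => [|n IHn] i; first by rewrite mul1r subn0.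
rewrite exprS -mulrA fcoef_qM; case: i => [|i]; first by [].
by rewrite IHn subSS ltnS.
Qed.

Lemma fcoef_qn n i : fcoef (q ^+ n) i = (i == n)%:R.
Proof.
rewrite -[q ^+ n]mulr1 fcoef_qnM fcoef1 subn_eq0 eqn_leq andbC.
by case: (n <= i)%N => //=.
Qed.

(** Congruence modulo [q ^+ N]. In particular [eqm 1 Q 0] says that [Q] has no constant term, so
    that its powers tend to 0. *)
Definition eqm N f g := forall i, (i < N)%N -> fcoef f i = fcoef g i.

Lemma eqm_refl {N f} : eqm N f f.
Proof. by []. Qed.

Lemma eqm_sym {N f g} : eqm N f g -> eqm N g f.
Proof. by move=> fg i /fg. Qed.

Lemma eqm_trans {N g f h} : eqm N f g -> eqm N g h -> eqm N f h.
Proof. by move=> fg gh i ltiN; rewrite fg ?gh. Qed.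

Lemma eqm_le {N} M {f g} : (N <= M)%N -> eqm M f g -> eqm N f g.
Proof. by move=> leNM fg i ltiN; apply/fg/(leq_trans ltiN). Qed.

Lemma eqmD {N f g f' g'} : eqm N f g -> eqm N f' g' -> eqm N (f + f') (g + g').
Proof. by move=> fg fg' i ltiN; rewrite !fcoefD fg ?fg'. Qed.

Lemma eqmN N f g : eqm N f g -> eqm N (- f) (- g).
Proof. by move=> fg i ltiN; rewrite !fcoefN fg. Qed.

Lemma eqmM {N f g f' g'} : eqm N f g -> eqm N f' g' -> eqm N (f * f') (g * g').
Proof.
move=> fg fg' i ltiN; rewrite !fcoefM; apply: eq_bigr => j _.
have leji : (j <= i)%N by rewrite -ltnS.
by rewrite fg ?fg' ?(leq_ltn_trans _ ltiN) ?leq_subr.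
Qed.

Lemma eqmX N f g n : eqm N f g -> eqm N (f ^+ n) (g ^+ n).
Proof. by move=> fg; elim: n => // n IHn; rewrite !exprS; apply: eqmM. Qed.

Lemma eqm_sub0 N f g : eqm N (f - g) 0 <-> eqm N f g.
Proof.
split=> fg i /fg; rewrite fcoefB; first by move/eqP; rewrite subr_eq0 => /eqP.
by move=> ->; rewrite subrr.
Qed.

Lemma eqm0M N M f g : eqm N f 0 -> eqm M g 0 -> eqm (N + M) (f * g) 0.
Proof.
move=> f0 g0 i lti; rewrite fcoefM big1 // => j _.
have [ltjN|leNj] := ltnP j N; first by rewrite f0 // mul0r.
by rewrite g0 ?mulr0 // ltn_subLR ?(leq_trans lti) ?leq_add2r // -ltnS.
Qed.

Lemma eqm0X N f n : eqm N f 0 -> eqm (n * N) (f ^+ n) 0.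
Proof. by move=> f0; elim: n => // n IHn; rewrite exprS mulSn; apply: eqm0M. Qed.

Lemma eqm0Ml N f g : eqm N f 0 -> eqm N (g * f) 0.
Proof. by move=> f0; rewrite -[N]add0n; apply: eqm0M. Qed.

Lemma eqm_sum N n (F G : 'I_n -> fps) :
  (forall i, eqm N (F i) (G i)) -> eqm N (\sum_i F i) (\sum_i G i).
Proof. by move=> FG i lti; rewrite !fcoef_sum; apply: eq_bigr => j _; apply: FG. Qed.

Lemma fps_unitE f : (f \is a GRing.unit) = (fcoef f 0 \is a GRing.unit).
Proof. by []. Qed.

Lemma fps_unit1 f : fcoef f 0 = 1 -> f \is a GRing.unit.
Proof. by rewrite fps_unitE => ->. Qed.

Lemma eqm_unit f : eqm 1 f 1 -> f \is a GRing.unit.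
Proof. by move=> f1; apply: fps_unit1; rewrite f1. Qed.

Lemma eqmMI N f g h : f \is a GRing.unit -> eqm N (f * g) (f * h) -> eqm N g h.
Proof.
by move=> Uf /(eqmM (@eqm_refl N f^-1)); rewrite !mulKr.
Qed.

(** * Finite products (Q; Q)_n and sums over |k| <= n *)

Definition qpoch Q n : fps := \prod_(j < n) (1 - Q ^+ j.+1).

Lemma qpoch0 Q : qpoch Q 0 = 1.
Proof. exact: big_ord0. Qed.

Lemma qpochS Q n : qpoch Q n.+1 = qpoch Q n * (1 - Q ^+ n.+1).
Proof. exact: big_ord_recr. Qed.

Lemma eqm_1B N f : eqm N f 0 -> eqm N (1 - f) 1.
Proof. by move=> f0 i /f0; rewrite fcoefB => ->; rewrite subr0. Qed.

Lemma eqm0_expr Q n : eqm 1 Q 0 -> eqm n (Q ^+ n) 0.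
Proof. by move=> Q0; rewrite -{1}[n]muln1; apply: eqm0X. Qed.

Lemma qpoch_eqm Q n m : eqm 1 Q 0 -> (n <= m)%N -> eqm n.+1 (qpoch Q m) (qpoch Q n).
Proof.
move=> Q0; elim: m => [|m IHm]; first by rewrite leqn0 => /eqP->.
rewrite leq_eqVlt => /predU1P[-> //|lenm].
rewrite qpochS -[X in eqm _ _ X]mulr1; apply: eqmM; first exact: IHm.
by apply: (eqm_le m.+1) => //; apply/eqm_1B/eqm0_expr.
Qed.

Lemma qpoch_unit Q n : eqm 1 Q 0 -> qpoch Q n \is a GRing.unit.
Proof. by move=> Q0; apply: eqm_unit; rewrite -(qpoch0 Q); apply: qpoch_eqm. Qed.

Definition symsum n (F : int -> fps) : fps := \sum_(i < n.*2.+1) F (i%:Z - n%:Z).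

Lemma symsum_ext n F G :
  (forall k, (`|k| <= n)%N -> F k = G k) -> symsum n F = symsum n G.
Proof. move=> FG; apply: eq_bigr => -[i lti] _; apply: FG => /=; lia. Qed.

Lemma symsum0 F : symsum 0 F = F 0.
Proof. by rewrite /symsum big_ord1. Qed.

Lemma symsumD n F G : symsum n (fun k => F k + G k) = symsum n F + symsum n G.
Proof. exact: big_split. Qed.

Lemma symsumMl n f F : symsum n (fun k => f * F k) = f * symsum n F.
Proof. by rewrite /symsum mulr_sumr. Qed.

Lemma symsum_shift n F :
  symsum n (fun k => F (k + 1)) + F (- n%:Z) = symsum n F + F n.+1%:Z.
Proof.
transitivity (\sum_(i < n.*2.+2) F (i%:Z - n%:Z)).
  rewrite big_ord_recl addrC /symsum /= sub0r; congr (_ + _).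
  by apply: eq_bigr => i _; congr F; rewrite /= /bump /=; lia.
by rewrite big_ord_recr /symsum /=; congr (_ + F _); lia.
Qed.

Lemma symsumS n F : symsum n.+1 F = symsum n F + F n.+1%:Z + F (- n.+1%:Z).
Proof.
rewrite /symsum doubleS big_ord_recl big_ord_recr addrC /=.
congr (_ + F _ + F _); rewrite /bump; [|lia|lia].
by apply: eq_bigr => i _; congr F; rewrite /= /bump; lia.
Qed.

Lemma symsum_opp n F : symsum n (fun k => F (- k)) = symsum n F.
Proof.
elim: n => [|n IHn]; first by rewrite !symsum0 oppr0.
by rewrite !symsumS IHn opprK -!addrA [F (- _) + _]addrC.
Qed.

(** The cutoff 3 n + 1 is the one at which the classes 3k, 3k + 1 and 3k - 1 all have the same range
    |k| <= n. *)
Lemma symsum3 n F :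
  symsum (3 * n).+1 F =
  symsum n (fun k => F (3 * k)) + symsum n (fun k => F (3 * k + 1))
    + symsum n (fun k => F (3 * k - 1)).
Proof.
elim: n => [|n IHn].
  by rewrite muln0 symsumS !symsum0.
have -> : ((3 * n.+1).+1 = (3 * n).+1.+3)%N by lia.
rewrite 3!symsumS IHn !symsumS.
have E1 : (3 * n).+1.+2%:Z = 3 * n.+1%:Z by lia.
have E2 : (3 * n).+1.+1%:Z = 3 * n.+1%:Z - 1 by lia.
have E3 : (3 * n).+1.+3%:Z = 3 * n.+1%:Z + 1 by lia.
rewrite E1 E2 E3 !mulrN !opprD opprK; ring.
Qed.

Lemma eqm_symsum N n F G :
  (forall k, (`|k| <= n)%N -> eqm N (F k) (G k)) -> eqm N (symsum n F) (symsum n G).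
Proof. move=> FG; apply: eqm_sum => -[i lti]; apply: FG => /=; lia. Qed.

Lemma symsum_eqm N n m F : (n <= m)%N ->
  (forall k, (n < `|k|)%N -> eqm N (F k) 0) -> eqm N (symsum m F) (symsum n F).
Proof.
move=> + F0; elim: m => [|m IHm]; first by rewrite leqn0 => /eqP->.
rewrite leq_eqVlt => /predU1P[-> //|lenm].
rewrite symsumS -[X in eqm _ _ X]addr0 -[X in eqm _ _ (X + _)]addr0.
by apply: eqmD; [apply: eqmD; [exact: IHm|]|]; apply: F0; lia.
Qed.

(** * The triple product *)

(** The range |k| <= n + 1 still contains the support after a shift by one either way. *)
Lemma symsum_supp n F :
  (forall k, (n < `|k|)%N -> F k = 0) ->
  [/\ symsum n.+1 F = symsum n F,
      symsum n.+1 (fun k => F (k + 1)) = symsum n F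
    & symsum n.+1 (fun k => F (k - 1)) = symsum n F].
Proof.
have wide G : (forall k, (n < `|k|)%N -> G k = 0) -> symsum n.+1 G = symsum n G.
  by move=> G0; rewrite symsumS !G0 ?addr0.
have shift G : (forall k, (n < `|k|)%N -> G k = 0) ->
    symsum n.+1 (fun k => G (k + 1)) = symsum n G.
  by move=> G0; have := symsum_shift n.+1 G; rewrite (wide G) // !G0 ?addr0 //; lia.
move=> F0; split; [exact: wide|exact: shift|].
rewrite -(symsum_opp n F) -(shift (fun k => F (- k))) => [|k kn]; last by rewrite F0 //; lia.
rewrite -[LHS]symsum_opp; apply: symsum_ext => k _; congr F; lia.
Qed.

(** This is a^(k(k+1)/2) b^(k(k-1)/2). Extracting the power of [a * b] shows its order in q even
    when [b] is 1 or -1. *)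
Definition theta_term a b k : fps :=
  match k with
  | Posz m => (a * b) ^+ 'C(m, 2) * a ^+ m
  | Negz m => (a * b) ^+ 'C(m.+1, 2) * b ^+ m.+1
  end.

Lemma theta_term_opp a b k : theta_term a b (- k) = theta_term b a k.
Proof. by case: k => [[|m]|m] //; rewrite [in RHS]/= [b * a]mulrC. Qed.

Lemma bin2S m : 'C(m.+1, 2) = ('C(m, 2) + m)%N.
Proof. by rewrite binS bin1. Qed.

Lemma bin2_mul3 m : 'C(3 * m, 2) = (9 * 'C(m, 2) + 3 * m)%N.
Proof. by elim: m => // m IHm; rewrite mulnS !bin2S; lia. Qed.

(** The ratio of consecutive terms is a (ab)^k; the factor (ab)^n keeps exponents nonnegative. *)
Lemma theta_term_succ a b n k : (`|k| <= n)%N ->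
  a * (a * b) ^+ n * theta_term a b k = (a * b) ^+ absz (n%:Z - k)%R * theta_term a b (k + 1).
Proof.
case: k => [m|m] lekn.
- have -> : Posz m + 1 = m.+1 by lia.
  have -> : absz (n%:Z - m%:Z)%R = (n - m)%N by lia.
  have -> : n = (n - m + m)%N by rewrite subnK.
  rewrite addnK [theta_term _ _ _]/= [in RHS]/= bin2S !exprD exprS; ring.
have -> : Negz m + 1 = - m%:Z by lia.
rewrite theta_term_opp.
have -> : absz (n%:Z - Negz m)%R = (n + m.+1)%N by lia.
rewrite [theta_term _ _ _]/= [in RHS]/= [b * a]mulrC bin2S !exprD !exprS; ring.
Qed.

Lemma theta_term_pred a b n k : (`|k| <= n)%N ->
  b * (a * b) ^+ n * theta_term a b k = (a * b) ^+ absz (n%:Z + k)%R * theta_term a b (k - 1).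
Proof.
move=> lekn; have := @theta_term_succ b a n (- k); rewrite abszN => /(_ lekn).
have -> : - k + 1 = - (k - 1) by lia.
by rewrite opprK !theta_term_opp [b * a]mulrC.
Qed.

(* The value 0 for k < 0 makes qpoch_inv_pred hold at m = 0 too, so that qbinS *)
(* has no boundary cases.                                                     *)
Definition qpoch_inv Q k : fps := if k is Posz m then (qpoch Q m)^-1 else 0.

Lemma qpoch_inv_pred Q m : eqm 1 Q 0 ->
  qpoch_inv Q (m%:Z - 1) = (1 - Q ^+ m) * qpoch_inv Q m.
Proof.
case: m => [|m] Q0; first by rewrite expr0 subrr mul0r.
have -> : m.+1%:Z - 1 = m by lia.
have := qpoch_unit Q m.+1 Q0; rewrite /= qpochS unitrM => /andP[U1 U2].
by rewrite invrM // mulVKr.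
Qed.

(* The central Gaussian binomial coefficient [2n, n + k]. *)
Definition qbin Q n k : fps := qpoch Q n.*2 * qpoch_inv Q (n%:Z + k) * qpoch_inv Q (n%:Z - k).

Lemma qbin_small Q n k : (n < `|k|)%N -> qbin Q n k = 0.
Proof.
move=> ltnk; rewrite /qbin; case: k ltnk => k ltnk.
  by have -> : n%:Z - Posz k = Negz (k - n).-1; [lia|rewrite mulr0].
by have -> : n%:Z + Negz k = Negz (k - n); [lia|rewrite mulr0 mul0r].
Qed.

(** Pascal's rule for Gaussian binomials used twice, from row 2n + 2 down to row 2n; verified here
    by clearing denominators. *)
Lemma qbinS Q n k : eqm 1 Q 0 -> (`|k| <= n.+1)%N ->
  qbin Q n.+1 k = (1 + Q ^+ n.*2.+1) * qbin Q n k
    + Q ^+ absz (n%:Z - (k - 1))%R * qbin Q n (k - 1)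
    + Q ^+ absz (n%:Z + (k + 1))%R * qbin Q n (k + 1).
Proof.
move=> Q0 lekn.
have [s [t [Es Et]]] : exists s t : nat, s%:Z = n.+1%:Z - k /\ t%:Z = n.+1%:Z + k.
  by exists (absz (n.+1%:Z - k)%R), (absz (n.+1%:Z + k)%R); lia.
have -> : absz (n%:Z - (k - 1))%R = s by lia.
have -> : absz (n%:Z + (k + 1))%R = t by lia.
rewrite /qbin -Es -Et.
have -> : n%:Z + k = t%:Z - 1 by lia.
have -> : n%:Z - k = s%:Z - 1 by lia.
have -> : n%:Z - (k - 1) = s by lia.
have -> : n%:Z + (k + 1) = t by lia.
have -> : n%:Z + (k - 1) = t%:Z - 1 - 1 by lia.
have -> : n%:Z - (k + 1) = s%:Z - 1 - 1 by lia.
rewrite doubleS !qpochS !qpoch_inv_pred //.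
(* At [u = 0] the truncated [u.-1] does no harm, since the factor [1 - Q ^+ u] vanishes. *)
have pred2 u : qpoch_inv Q (u%:Z - 1 - 1) = (1 - Q ^+ u.-1) * (1 - Q ^+ u) * qpoch_inv Q u.
  case: u => [|u]; first by rewrite /= subrr mulr0 mul0r.
  have -> : u.+1%:Z - 1 = u by lia.
  rewrite qpoch_inv_pred // -mulrA -(qpoch_inv_pred Q u.+1) //.
  by have -> : u.+1%:Z - 1 = u by lia.
rewrite !pred2 {Q0 pred2}.
have Est : (s + t = n.*2.+2)%N by lia.
case: s t {Es Et} Est => [|s] [|t] // Est.
- have <- : (t = n.*2.+1)%N by lia.
  rewrite /= expr0 subrr exprS; ring.
- have <- : (s = n.*2.+1)%N by lia.
  rewrite /= expr0 subrr exprS; ring.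
have <- : (s + t = n.*2)%N by lia.
rewrite /= !exprS !exprD; ring.
Qed.

(** Reindexing moves the shifts in [qbinS] onto the weight. A general [w] serves both w = 1 and w =
    k. *)
Lemma symsum_qbinS a b n (w : int -> fps) : eqm 1 (a * b) 0 ->
  symsum n.+1 (fun k => w k * qbin (a * b) n.+1 k * theta_term a b k) =
  symsum n (fun k => ((1 + (a * b) ^+ n.*2.+1) * w k + a * (a * b) ^+ n * w (k + 1)
                      + b * (a * b) ^+ n * w (k - 1))
                     * qbin (a * b) n k * theta_term a b k).
Proof.
set Q := a * b => Q0; pose c := qbin Q n; pose T := theta_term a b.
pose G0 k := (1 + Q ^+ n.*2.+1) * w k * c k * T k.
pose G1 k := a * Q ^+ n * w (k + 1) * c k * T k.
pose G2 k := b * Q ^+ n * w (k - 1) * c k * T k.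
have vanish G : (forall k, (n < `|k|)%N -> G k * c k * T k = 0).
  by move=> k ltnk; rewrite /c qbin_small // mulr0 mul0r.
have [E0 _ _] := @symsum_supp n G0 (vanish _).
have [_ _ E1] := @symsum_supp n G1 (vanish _).
have [_ E2 _] := @symsum_supp n G2 (vanish _).
transitivity (symsum n G0 + symsum n G1 + symsum n G2); last first.
  by rewrite -!symsumD; apply: symsum_ext => k _; rewrite /G0 /G1 /G2 /c /T -!mulrDl.
rewrite -E0 -E1 -E2 -!symsumD; apply: symsum_ext => k lekn.
rewrite qbinS // /G1 /G2 subrK addrK.
have shift1 : a * Q ^+ n * c (k - 1) * T (k - 1) = Q ^+ absz (n%:Z - (k - 1))%R * c (k - 1) * T k.
  have [ltnk|lekn1] := ltnP n `|k - 1|; first by rewrite /c qbin_small // !(mulr0, mul0r).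
  by rewrite mulrAC theta_term_succ // subrK mulrAC.
have shift2 : b * Q ^+ n * c (k + 1) * T (k + 1) = Q ^+ absz (n%:Z + (k + 1))%R * c (k + 1) * T k.
  have [ltnk|lekn1] := ltnP n `|k + 1|; first by rewrite /c qbin_small // !(mulr0, mul0r).
  by rewrite mulrAC theta_term_pred // addrK mulrAC.
transitivity (G0 k + w k * (a * Q ^+ n * c (k - 1) * T (k - 1))
                + w k * (b * Q ^+ n * c (k + 1) * T (k + 1))).
  rewrite shift1 shift2 /G0 /c /T; ring.
ring.
Qed.

Definition theta_prod a b n : fps :=
  \prod_(j < n) ((1 + a * (a * b) ^+ j) * (1 + b * (a * b) ^+ j)).

Lemma theta_prodS a b n : theta_prod a b n.+1 =
  theta_prod a b n * ((1 + a * (a * b) ^+ n) * (1 + b * (a * b) ^+ n)).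
Proof. exact: big_ord_recr. Qed.

(** MacMahon's finite form of the triple product. For w = 1 the bracket in [symsum_qbinS] is (1 + a
    Q^n)(1 + b Q^n), because ab = Q. *)
Lemma finite_triple_product a b n : eqm 1 (a * b) 0 ->
  symsum n (fun k => qbin (a * b) n k * theta_term a b k) = theta_prod a b n.
Proof.
move=> Q0; elim: n => [|n IHn].
  by rewrite symsum0 /theta_prod big_ord0 /qbin /= !qpoch0 !invr1 !mulr1.
have := symsum_qbinS a b n (fun=> 1) Q0.
rewrite (symsum_ext _ _ (fun k => qbin (a * b) n.+1 k * theta_term a b k)); last first.
  by move=> k _; rewrite mul1r.
move=> ->; rewrite theta_prodS -IHn [RHS]mulrC -symsumMl.
apply: symsum_ext => k _; rewrite exprS -addnn exprD; ring.
Qed.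

(* The image of theta_prod under the derivation with D a = a and D b = - b,   *)
(* which kills a * b and multiplies theta_term a b k by k.                    *)
Fixpoint theta_prod_deriv a b n : fps :=
  if n is n'.+1 then
    theta_prod_deriv a b n' * ((1 + a * (a * b) ^+ n') * (1 + b * (a * b) ^+ n'))
    + theta_prod a b n' * ((a - b) * (a * b) ^+ n')
  else 0.

(** For w = k the bracket is k (1 + a Q^n)(1 + b Q^n) + (a - b) Q^n, which is the recursion of
    [theta_prod_deriv]. *)
Lemma finite_triple_product_deriv a b n : eqm 1 (a * b) 0 ->
  symsum n (fun k => k%:~R * qbin (a * b) n k * theta_term a b k) = theta_prod_deriv a b n.
Proof.
move=> Q0; elim: n => [|n IHn].
  by rewrite symsum0 !mul0r.
rewrite (symsum_qbinS a b n (fun k => k%:~R) Q0) /= -IHn -finite_triple_product //.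
rewrite [X in _ = X + _]mulrC [X in _ = _ + X]mulrC -!symsumMl -symsumD.
apply: symsum_ext => k _; rewrite exprS -addnn exprD !intrD; ring.
Qed.

(** * From the finite triple product to the infinite one *)

Lemma theta_term_order a b k : eqm 1 (a * b) 0 -> eqm 'C(`|k|, 2) (theta_term a b k) 0.
Proof. by move=> Q0; case: k => m; rewrite /= mulrC; apply/eqm0Ml/eqm0_expr. Qed.

Lemma leq_bin2 m : (m <= 'C(m, 2).+1)%N.
Proof. by elim: m => // m IHm; rewrite bin2S; case: m IHm => // m; lia. Qed.

Lemma symsum_theta_term_le a b (w : int -> fps) n m : eqm 1 (a * b) 0 -> (n <= m)%N ->
  eqm n (symsum m (fun k => w k * theta_term a b k)) (symsum n (fun k => w k * theta_term a b k)).
Proof.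
move=> Q0 lenm; apply: symsum_eqm => // k ltnk; apply: eqm0Ml.
apply: (eqm_le 'C(`|k|, 2)); last exact: theta_term_order.
by rewrite -ltnS (leq_trans ltnk) // leq_bin2.
Qed.

(** Both (Q)_n / (Q)_(n-|k|) and (Q)_2n / (Q)_(n+|k|) are 1 up to the first factor left over. *)
Lemma qbin_eqm Q n k : eqm 1 Q 0 -> (`|k| <= n)%N ->
  eqm (n - `|k|).+1 (qpoch Q n * qbin Q n k) 1.
Proof.
move=> Q0 lekn.
have ratio m M : (m <= M)%N -> eqm m.+1 (qpoch Q M * (qpoch Q m)^-1) 1.
  move=> lemM; rewrite -(divrr (qpoch_unit Q m Q0)).
  by apply: eqmM => //; apply: qpoch_eqm.
wlog k_ge0 : k lekn / 0 <= k => [Hw|].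
  have [|k_lt0] := leP 0 k; first exact: Hw.
  by rewrite -abszN; have := Hw (- k); rewrite /qbin opprK mulrAC; apply; lia.
case: k k_ge0 lekn => // k _ lekn; rewrite /qbin.
have -> : n%:Z - k%:Z = (n - k)%N by lia.
rewrite -[X in eqm _ _ X]mulr1 mulrCA.
apply: eqmM; last by apply: ratio; lia.
by apply: (eqm_le (n + k).+1); [lia | apply: ratio; lia].
Qed.

Lemma symsum_qbin_eqm a b (w : int -> fps) n : eqm 1 (a * b) 0 ->
  eqm n (symsum n (fun k => w k * theta_term a b k))
        (qpoch (a * b) n * symsum n (fun k => w k * qbin (a * b) n k * theta_term a b k)).
Proof.
move=> Q0; rewrite -symsumMl; apply: eqm_symsum => k lekn.
apply/eqm_sym/eqm_sub0; set c := qbin _ _ _; set T := theta_term _ _ _.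
have -> : qpoch (a * b) n * (w k * c * T) - w k * T = w k * ((qpoch (a * b) n * c - 1) * T).
  ring.
(* The binomial is accurate only to order n - |k| + 1, but the term itself has order at least
   'C(|k|, 2) >= |k| - 1. *)
apply: eqm0Ml; apply: (eqm_le ((n - `|k|).+1 + 'C(`|k|, 2))%N).
  by have := leq_bin2 `|k|; lia.
by apply: eqm0M; [apply/eqm_sub0/qbin_eqm|apply: theta_term_order].
Qed.

(** The order condition bears on [a * b], which admits b = 1 and b = -1. *)
Lemma triple_product a b N n m : eqm 1 (a * b) 0 -> (N <= n)%N -> (N <= m)%N ->
  eqm N (symsum m (theta_term a b)) (qpoch (a * b) n * theta_prod a b n).
Proof.
move=> Q0 leNn leNm; rewrite -finite_triple_product //.
have theta1 j : symsum j (fun k => 1 * theta_term a b k) = symsum j (theta_term a b).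
  by apply: symsum_ext => k _; rewrite mul1r.
have:= symsum_theta_term_le a b (fun=> 1) _ _ Q0 leNm; rewrite !theta1 => /eqm_trans; apply.
have:= symsum_theta_term_le a b (fun=> 1) _ _ Q0 leNn; rewrite !theta1 => /eqm_sym.
move=> /eqm_trans; apply; rewrite -theta1; apply: (eqm_le n) => //.
by have:= symsum_qbin_eqm a b (fun=> 1) n Q0; under [X in qpoch _ _ * X]symsum_ext do rewrite mul1r.
Qed.

Lemma triple_product_deriv a b N n m : eqm 1 (a * b) 0 -> (N <= n)%N -> (N <= m)%N ->
  eqm N (symsum m (fun k => k%:~R * theta_term a b k))
        (qpoch (a * b) n * theta_prod_deriv a b n).
Proof.
move=> Q0 leNn leNm; rewrite -finite_triple_product_deriv //.
apply: eqm_trans (symsum_theta_term_le a b (fun k => k%:~R) _ _ Q0 leNm) _.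
apply: eqm_trans (eqm_sym (symsum_theta_term_le a b (fun k => k%:~R) _ _ Q0 leNn)) _.
by apply: (eqm_le n) => //; apply: symsum_qbin_eqm.
Qed.

(** * Theta series and their splitting mod 3 *)

Definition theta a b n : fps := symsum n (theta_term a b).

Definition dtheta a b n : fps := symsum n (fun k => k%:~R * theta_term a b k).

Lemma theta_sym a b n : theta a b n = theta b a n.
Proof. by rewrite /theta -symsum_opp; apply: symsum_ext => k _; rewrite theta_term_opp. Qed.

Lemma dtheta_anti a b n : dtheta a b n = - dtheta b a n.
Proof.
rewrite /dtheta -symsum_opp -mulN1r -symsumMl; apply: symsum_ext => k _.
by rewrite theta_term_opp rmorphN mulN1r mulNr.
Qed.

Lemma theta_term_mul3 a b k :
  theta_term a b (3 * k) = theta_term (a ^+ 6 * b ^+ 3) (a ^+ 3 * b ^+ 6) k.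
Proof.
have nonneg a' b' m :
    theta_term a' b' (3 * m%:Z) = theta_term (a' ^+ 6 * b' ^+ 3) (a' ^+ 3 * b' ^+ 6) m.
  rewrite -PoszM /theta_term bin2_mul3 exprD !exprM.
  have -> : a' ^+ 6 * b' ^+ 3 * (a' ^+ 3 * b' ^+ 6) = (a' * b') ^+ 9 by ring.
  have -> : a' ^+ 6 * b' ^+ 3 = (a' * b') ^+ 3 * a' ^+ 3 by ring.
  by rewrite [((a' * b') ^+ 3 * _) ^+ m]exprMn mulrA.
case: k => m; first exact: nonneg.
rewrite NegzE mulrN !theta_term_opp nonneg; congr (theta_term _ _ _); exact: mulrC.
Qed.

Lemma theta_term_mul3_add1 a b k :
  theta_term a b (3 * k + 1) = a * theta_term (a ^+ 9 * b ^+ 6) (b ^+ 3) k.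
Proof.
case: k => m.
  have -> : 3 * Posz m + 1 = (3 * m).+1%N by lia.
  rewrite /theta_term bin2S bin2_mul3 -addnA -mulnDl exprS exprD !exprM.
  have -> : a ^+ 9 * b ^+ 6 * b ^+ 3 = (a * b) ^+ 9 by ring.
  have -> : a ^+ 9 * b ^+ 6 = (a * b) ^+ 6 * a ^+ 3 by ring.
  rewrite [((a * b) ^+ 6 * _) ^+ m]exprMn; ring.
have -> : 3 * Negz m + 1 = Negz (3 * m).+1 by lia.
rewrite /theta_term !bin2S bin2_mul3.
have -> : (9 * 'C(m, 2) + 3 * m + 3 * m + (3 * m).+1 = (9 * 'C(m, 2) + 9 * m).+1)%N by lia.
have -> : a ^+ 9 * b ^+ 6 * b ^+ 3 = (a * b) ^+ 9 by ring.
have -> : (a * b) ^+ (9 * 'C(m, 2) + 9 * m).+1 = a * b * (a * b) ^+ 9 ^+ ('C(m, 2) + m).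
  by rewrite -mulnDr exprS exprM.
have -> : b ^+ (3 * m).+2 = b * (b * b ^+ 3 ^+ m) by rewrite 2!exprS exprM.
rewrite [b ^+ 3 ^+ m.+1]exprS.
set X := _ ^+ ('C(m, 2) + m); set Y := _ ^+ m; ring.
Qed.

Lemma theta_term_mul3_sub1 a b k :
  theta_term a b (3 * k - 1) = b * theta_term (a ^+ 3) (a ^+ 6 * b ^+ 9) k.
Proof.
rewrite -[3 * k - 1]opprK theta_term_opp opprB addrC -mulrN theta_term_mul3_add1.
by rewrite theta_term_opp [b ^+ 9 * _]mulrC.
Qed.

Lemma theta_dissection a b n : theta a b (3 * n).+1 =
  theta (a ^+ 6 * b ^+ 3) (a ^+ 3 * b ^+ 6) n
  + a * theta (a ^+ 9 * b ^+ 6) (b ^+ 3) n + b * theta (a ^+ 3) (a ^+ 6 * b ^+ 9) n.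
Proof.
rewrite /theta symsum3 -!symsumMl; congr (_ + _ + _); apply: symsum_ext => k _.
- exact: theta_term_mul3.
- exact: theta_term_mul3_add1.
exact: theta_term_mul3_sub1.
Qed.

(** The weights 3k + 1 and 3k - 1 give [3 * dtheta] plus or minus [theta]. *)
Lemma dtheta_dissection a b n : dtheta a b (3 * n).+1 =
  3 * dtheta (a ^+ 6 * b ^+ 3) (a ^+ 3 * b ^+ 6) n
  + a * (3 * dtheta (a ^+ 9 * b ^+ 6) (b ^+ 3) n + theta (a ^+ 9 * b ^+ 6) (b ^+ 3) n)
  + b * (3 * dtheta (a ^+ 3) (a ^+ 6 * b ^+ 9) n - theta (a ^+ 3) (a ^+ 6 * b ^+ 9) n).
Proof.
rewrite /dtheta /theta symsum3; congr (_ + _ + _).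
- rewrite -symsumMl; apply: symsum_ext => k _.
  by rewrite theta_term_mul3 intrM rmorph_nat -mulrA.
- rewrite -symsumMl -symsumD -symsumMl; apply: symsum_ext => k _.
  rewrite theta_term_mul3_add1 intrD intrM rmorph_nat.
  set T := theta_term _ _ k; ring.
rewrite -[- symsum _ _]mulN1r -!symsumMl -symsumD -symsumMl; apply: symsum_ext => k _.
rewrite theta_term_mul3_sub1 intrD intrM rmorph_nat.
set T := theta_term _ _ k; ring.
Qed.

(** * Signs of coefficients *)

Lemma eqm_euler j n N : (0 < j)%N -> (N <= n)%N -> eqm N (euler j) (qpoch (q ^+ j) n).
Proof.
move=> j_gt0 leNn i ltiN.
rewrite (@fcoef_eulerE j i n) //; last by lia.
suff -> : qpoch (q ^+ j) n =
    Fps (fun i => (\prod_(1 <= k < n.+1) (1 - 'X^(j * k)) : {poly int})`_i) by [].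
elim: n {leNn} => [|n IHn].
  by rewrite qpoch0 big_geq //; apply: fpsP => l; rewrite /= coef1.
rewrite qpochS IHn; apply: fpsP => l; rewrite [RHS]/= [in RHS]big_nat_recr // coefM.
apply: eq_bigr => s _; congr (_ * _).
by rewrite -exprM fcoefB fcoef1 fcoef_qn coefB coef1 coefXn.
Qed.

(** Series in q^3 with nonnegative coefficients. *)
Definition nneg3 f := forall i, 0 <= fcoef f i /\ (~~ (3 %| i)%N -> fcoef f i = 0).

Definition nneg3_1 f := nneg3 f /\ fcoef f 0 = 1.

Definition pos3 f := nneg3 f /\ forall n, 0 < fcoef f (3 * n).

Lemma nneg3D f g : nneg3 f -> nneg3 g -> nneg3 (f + g).
Proof.
move=> f_ge0 g_ge0 i; have [[fi f3] [gi g3]] := (f_ge0 i, g_ge0 i).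
by split=> [|i3]; [apply: addr_ge0|rewrite fcoefD f3 ?g3].
Qed.

Lemma nneg3M f g : nneg3 f -> nneg3 g -> nneg3 (f * g).
Proof.
move=> f_ge0 g_ge0 i; rewrite fcoefM; split=> [|i3].
  by apply: sumr_ge0 => j _; apply: mulr_ge0; [case: (f_ge0 j)|case: (g_ge0 (i - j)%N)].
apply: big1 => j _; have [j3|j3] := boolP (3 %| j)%N; last first.
  by rewrite (f_ge0 j).2 ?mul0r.
rewrite (g_ge0 _).2 ?mulr0 //; apply: contra i3 => ij3.
by rewrite -(subnK (_ : j <= i)%N) -1?ltnS // dvdn_add.
Qed.

Lemma nneg3_sum n (F : 'I_n -> fps) : (forall i, nneg3 (F i)) -> nneg3 (\sum_i F i).
Proof.
by move=> F_ge0; elim/big_ind: _ => //; exact: nneg3D.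
Qed.

Lemma nneg3_qn n : nneg3 (q ^+ (3 * n)).
Proof.
by move=> i; rewrite fcoef_qn; split=> [//|]; case: eqP => // ->; rewrite dvdn_mulr.
Qed.

Lemma nneg3_1M f g : nneg3_1 f -> nneg3_1 g -> nneg3_1 (f * g).
Proof.
by move=> [f_ge0 f1] [g_ge0 g1]; split; [apply: nneg3M|rewrite fcoefM0 f1 g1].
Qed.

Lemma nneg3_1_1 : nneg3_1 1.
Proof. by split=> //; apply: (nneg3_qn 0). Qed.

Lemma nneg3_1X n f : nneg3_1 f -> nneg3_1 (f ^+ n).
Proof.
move=> f1; elim: n => [|n IHn]; first exact: nneg3_1_1.
by rewrite exprS; apply: nneg3_1M.
Qed.

Lemma nneg3_1_prod n (F : 'I_n -> fps) :
  (forall i, nneg3_1 (F i)) -> nneg3_1 (\prod_i F i).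
Proof. by move=> F1; elim/big_ind: _ => //; [exact: nneg3_1_1 | exact: nneg3_1M]. Qed.

Lemma pos3D f g : pos3 f -> nneg3 g -> pos3 (f + g).
Proof.
move=> [f_ge0 f_gt0] g_ge0; split=> [|n]; first exact: nneg3D.
by rewrite fcoefD ltr_wpDr //; case: (g_ge0 (3 * n)%N).
Qed.

(** The constant term 1 of [g] reproduces each coefficient of [f], and the other contributions are
    nonnegative. *)
Lemma pos3M f g : pos3 f -> nneg3_1 g -> pos3 (f * g).
Proof.
move=> [f_ge0 f_gt0] [g_ge0 g1]; split=> [|n]; first exact: nneg3M.
rewrite fcoefM big_ord_recr /= subnn g1 mulr1 ltr_wpDl //.
by apply: sumr_ge0 => j _; apply: mulr_ge0; [case: (f_ge0 j)|case: (g_ge0 (3 * n - j)%N)].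
Qed.

Lemma pos3MrnS n f : pos3 f -> pos3 (f *+ n.+1).
Proof.
move=> f_pos; elim: n => [//|n [IHn _]]; rewrite mulrS; exact: pos3D.
Qed.

Lemma pos3_prod n (F : nat -> fps) : pos3 (F 0%N) -> (forall i, nneg3_1 (F i)) ->
  pos3 (\prod_(i < n.+1) F i).
Proof.
by move=> F0 F1; rewrite big_ord_recl; apply: pos3M => //; apply: nneg3_1_prod.
Qed.

(* Below, x stands for q^3. *)
Definition xsub n : fps := 1 - q ^+ (3 * n).
Definition xadd n : fps := 1 + q ^+ (3 * n).
Definition xgeo n : fps := Fps (fun i => (3 * n %| i)%N%:R).

Lemma xsubK n : (0 < n)%N -> xsub n * xgeo n = 1.
Proof.
move=> n_gt0; apply: fpsP => i; rewrite mulrBl mul1r fcoefB fcoef_qnM fcoef1 /=.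
have [lt3|] := leqP (3 * n) i; last first.
  case: i => [|i] lti; first by rewrite dvdn0 subr0.
  by rewrite gtnNdvd // subr0.
rewrite dvdn_subl // subrr; case: i lt3 => //; lia.
Qed.

Lemma nneg3_1_xgeo n : nneg3_1 (xgeo n).
Proof.
split; last by rewrite /= dvdn0.
move=> i; split=> [|i3] //=; case: (boolP (_ %| i)%N) => //.
by move/(dvdn_trans (dvdn_mulr n (dvdnn 3))); rewrite (negPf i3).
Qed.

Lemma nneg3_1_xadd n : (0 < n)%N -> nneg3_1 (xadd n).
Proof.
move=> n_gt0; split; first by apply: nneg3D; [exact: (nneg3_qn 0) | exact: nneg3_qn].
by rewrite fcoefD fcoef_qn fcoef1 eqxx; case: n n_gt0.
Qed.

Lemma pos3_xgeo1 : pos3 (xgeo 1).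
Proof.
by split=> [|n]; [case: (nneg3_1_xgeo 1)|rewrite /= muln1 dvdn_mulr].
Qed.

(* (1 - XY) / ((1 - X) (1 - Y)) = 1 / (1 - Y) + X / (1 - X). *)
Lemma nneg3_1_xsub_xgeo n m : (0 < n)%N -> (0 < m)%N ->
  nneg3_1 (xsub (n + m) * xgeo n * xgeo m).
Proof.
move=> n_gt0 m_gt0; have -> : xsub (n + m) * xgeo n * xgeo m = xgeo m + q ^+ (3 * n) * xgeo n.
  have E : xsub (n + m) = xsub n + q ^+ (3 * n) * xsub m.
    rewrite /xsub mulnDr exprD; ring.
  rewrite E; transitivity (xsub n * xgeo n * xgeo m + q ^+ (3 * n) * xgeo n * (xsub m * xgeo m)).
    ring.
  by rewrite !xsubK // mul1r mulr1.
split; last by rewrite fcoefD fcoef_qnM /= dvdn0 leqn0 muln_eq0 (gtn_eqF n_gt0) addr0.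
apply: nneg3D; first by case: (nneg3_1_xgeo m).
by apply: nneg3M; [exact: nneg3_qn | case: (nneg3_1_xgeo n)].
Qed.

(** [A] occupies the exponents 0 mod 3, [q * B] those 1 mod 3, and nothing those 2 mod 3. [A] and
    [B] may depend on [N]: a coefficient is read at one large enough [N]. *)
Lemma sign_pattern F :
  (forall N, exists A B, [/\ pos3 A, pos3 B & eqm N F (A - q * B)]) ->
  forall n, [/\ 0 < fcoef F (3 * n), fcoef F (3 * n + 1) < 0 & fcoef F (3 * n + 2) = 0].
Proof.
move=> FAB n; have [A [B [[A3 A_gt0] [B3 B_gt0] FE]]] := FAB (3 * n + 3)%N.
have ndvd r : (0 < r < 3)%N -> ~~ (3 %| 3 * n + r)%N.
  by move=> r3; rewrite dvdn_addr ?dvdn_mulr // gtnNdvd //; lia.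
have qB0 : fcoef (q * B) (3 * n) = 0.
  rewrite fcoef_qM; case En: (3 * n)%N => [//|i]; apply: (B3 i).2.
  by apply/negP => /dvdnP[d]; lia.
rewrite !FE; [|lia|lia|lia]; rewrite !fcoefB qB0.
rewrite (A3 (3 * n + 1)%N).2 ?(A3 (3 * n + 2)%N).2 ?ndvd // addn1 addn2 !fcoef_qM.
split; first by rewrite subr0.
  by rewrite sub0r oppr_lt0.
by rewrite -addn1 (B3 _).2 ?subr0 ?ndvd.
Qed.

(** * The quotient f_1^2 / f_2 *)

Lemma eqm_prod N n (F G : 'I_n -> fps) :
  (forall i, F i = G i) -> eqm N (\prod_i F i) (\prod_i G i).
Proof. by move=> FG; rewrite (eq_bigr G). Qed.

Lemma eqm1_qM f : eqm 1 (q * f) 0.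
Proof. by move=> [|//] _; rewrite fcoefM0 mul0r. Qed.

Lemma eqm1_qn n : (0 < n)%N -> eqm 1 (q ^+ n) 0.
Proof. by case: n => // n _; rewrite exprS; apply: eqm1_qM. Qed.

Lemma qpochM Q n d :
  qpoch Q (n * d) = \prod_(i < n) \prod_(r < d) (1 - Q ^+ (i * d + r).+1).
Proof.
elim: n => [|n IHn]; first by rewrite mul0n qpoch0 big_ord0.
by rewrite mulSn addnC big_ord_recr /= -IHn; apply: big_split_ord.
Qed.

Lemma qpoch2 Q n :
  qpoch Q (n * 2) = \prod_(i < n) ((1 - Q ^+ (2 * i + 1)) * (1 - Q ^+ (2 * i + 2))).
Proof.
rewrite qpochM; apply: eq_bigr => i _; rewrite !big_ord_recl big_ord0 mulr1 /=.
by congr ((1 - _ ^+ _) * (1 - _ ^+ _)); rewrite /bump; lia.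
Qed.

Lemma qpoch_x6 n : qpoch (q ^+ 3) (n * 6) =
  \prod_(i < n) (xsub (6 * i + 1) * xsub (6 * i + 2) * xsub (6 * i + 3)
                 * xsub (6 * i + 4) * xsub (6 * i + 5) * xsub (6 * i + 6)).
Proof.
rewrite qpochM; apply: eq_bigr => i _; rewrite !big_ord_recl big_ord0 mulr1 /= !mulrA.
by congr (_ * _ * _ * _ * _ * _); rewrite /xsub -exprM /bump; congr (1 - _ ^+ _); lia.
Qed.

Lemma euler3_x6 N n : (N <= n)%N -> eqm N (euler 3) (qpoch (q ^+ 3) (n * 6)).
Proof. by move=> leNn; apply: eqm_euler; lia. Qed.

(* The multiple c + 1 is 2 for f_1 f_4 / f_2: the triple product with b = 1   *)
(* gives twice that series, because of its factor 1 + b.                      *)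
Lemma sign_pattern_div f (c : nat) :
  (forall N, exists A B, [/\ pos3 A, pos3 B
     & eqm N (f *+ c.+1) ((A - q * B) * euler 3 ^+ 2)]) ->
  forall n, [/\ 0 < fcoef (f * euler 3 ^- 2) (3 * n), fcoef (f * euler 3 ^- 2) (3 * n + 1) < 0
    & fcoef (f * euler 3 ^- 2) (3 * n + 2) = 0].
Proof.
move=> fAB n; have U3 : euler 3 ^+ 2 \is a GRing.unit by rewrite unitrX // euler_unit.
have [|A_gt0 B_lt0 /eqP C0] := @sign_pattern ((f * euler 3 ^- 2) *+ c.+1) _ n.
  move=> N; have [A [B [Apos Bpos fE]]] := fAB N; exists A, B; split=> //.
  by have := eqmM fE (@eqm_refl N (euler 3 ^- 2)); rewrite mulrK // mulrnAl.
rewrite !fcoefMn in A_gt0 B_lt0 C0; split.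
- by rewrite pmulrn_lgt0 in A_gt0.
- by rewrite pmulrn_llt0 in B_lt0.
by apply/eqP; rewrite mulrn_eq0 in C0.
Qed.

Lemma eqm10 f : eqm 1 f 0 <-> fcoef f 0 = 0.
Proof. by split=> [|f0 [|//]]; first exact. Qed.

(** Gauss's product for phi(-z), the sum of (-1)^k z^(k^2). *)
Lemma theta_phi z N n m : eqm 1 z 0 -> (N <= n)%N -> (N <= m)%N ->
  eqm N (theta (- z) (- z) m)
        (\prod_(i < n) ((1 - z ^+ (2 * i + 1)) ^+ 2 * (1 - z ^+ (2 * i + 2)))).
Proof.
move=> z0 leNn leNm; have Q : - z * - z = z ^+ 2 by rewrite mulrNN.
have Q0 : eqm 1 (- z * - z) 0 by rewrite Q; apply: (eqm_le 2) => //; apply: eqm0_expr.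
apply: eqm_trans (triple_product _ _ _ _ _ Q0 leNn leNm) _.
rewrite Q /qpoch /theta_prod -big_split; apply: eqm_prod => i /=.
rewrite Q -!exprM mulnSr addn1 [z ^+ _.+1]exprS; set w := z ^+ (2 * i).
suff -> : (1 - z ^+ (2 * i + 2)) * ((1 + - z * w) * (1 + - z * w)) =
  (1 - z * w) ^+ 2 * (1 - z ^+ (2 * i + 2)) by [].
ring.
Qed.

Lemma phi_euler N n : (N <= n)%N ->
  eqm N (euler 1 ^+ 2) (euler 2
    * \prod_(i < n) ((1 - q ^+ (2 * i + 1)) ^+ 2 * (1 - q ^+ (2 * i + 2)))).
Proof.
move=> leNn; have E1 : eqm N (euler 1) (qpoch (q ^+ 1) (n * 2)) by apply: eqm_euler; lia.
have E2 : eqm N (euler 2) (qpoch (q ^+ 2) n) by apply: eqm_euler.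
apply: eqm_trans (eqmX _ _ _ 2 E1) _.
apply: eqm_sym; apply: eqm_trans (eqmM E2 eqm_refl) _.
rewrite expr1 qpoch2 /qpoch -!big_split -prodrXl; apply: eqm_prod => i /=.
rewrite -exprM mulnSr.
set u := 1 - _; set v := 1 - _; ring.
Qed.

(** The two shifted parts of the dissection coincide, whence B doubled. In blocks of six factors of
    f_3^2, the factors [u i r] of each theta product cancel and only inverses [g i r] remain; block
    0 contains [xgeo 1]. *)
Lemma phi_split N : exists A B, [/\ pos3 A, pos3 B
  & eqm N (euler 1 ^+ 2 * (euler 2)^-1) ((A - q * B) * euler 3 ^+ 2)].
Proof.
pose u i r := xsub (6 * i + r); pose g i r := xgeo (6 * i + r).
have ug i r : u i r.+1 * g i r.+1 = 1 by apply: xsubK; lia.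
pose A i := g i 1%N ^+ 2 * g i 2%N ^+ 2 * g i 4%N ^+ 2 * g i 5%N ^+ 2 * g i 6%N.
pose B i := g i 1%N * g i 5%N * g i 6%N * g i 2%N ^+ 2 * g i 3%N ^+ 2 * g i 4%N ^+ 2.
have g1 i r : nneg3_1 (g i r) by apply: nneg3_1_xgeo.
(* A successor, so that block 0 is present. *)
pose n := N.+1; have leNn : (N <= n)%N by [].
exists (\prod_(i < n) A i), ((\prod_(i < n) B i) *+ 2); split.
- apply: pos3_prod => [|i]; last first.
    by do 4!(apply: nneg3_1M; last by [exact: nneg3_1X|]); apply: nneg3_1X.
  do 4!(apply: pos3M; last by [exact: nneg3_1X|]).
  by rewrite expr2; apply: pos3M => //; apply: pos3_xgeo1.
- apply/pos3MrnS/pos3_prod => [|i]; last first.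
    by do 5!(apply: nneg3_1M; last by [exact: nneg3_1X|]).
  by do 5!(apply: pos3M; last by [exact: nneg3_1X|]); apply: pos3_xgeo1.
have theta_euler : eqm N (euler 1 ^+ 2 * (euler 2)^-1) (theta (- q) (- q) (3 * n).+1).
  apply: eqmMI (euler_unit 2) _; rewrite mulrCA divrr ?euler_unit // mulr1.
  apply: eqm_trans (phi_euler _ _ leNn) _.
  apply: eqmM => //; apply: eqm_sym; apply: theta_phi => //; last lia.
  exact: (eqm1_qn 1).
apply: eqm_trans theta_euler _; rewrite theta_dissection.
have -> : (- q) ^+ 6 * (- q) ^+ 3 = - q ^+ 9 by ring.
have -> : (- q) ^+ 3 * (- q) ^+ 6 = - q ^+ 9 by ring.
have -> : (- q) ^+ 9 * (- q) ^+ 6 = - q ^+ 15 by ring.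
have -> : (- q) ^+ 6 * (- q) ^+ 9 = - q ^+ 15 by ring.
have -> : (- q) ^+ 3 = - q ^+ 3 by ring.
rewrite [theta (- q ^+ 3) _ _]theta_sym.
have E3 : eqm N (euler 3) _ := euler3_x6 _ _ leNn.
have th0 : eqm N (theta (- q ^+ 9) (- q ^+ 9) n) (\prod_(i < n) A i * euler 3 ^+ 2).
  apply: eqm_trans (theta_phi _ _ n n (eqm1_qn 9 isT) leNn leNn) _.
  apply: eqm_sym; apply: eqm_trans (eqmM eqm_refl (eqmX _ _ _ 2 E3)) _.
  rewrite qpoch_x6 -prodrXl -big_split; apply: eqm_prod => i /=.
  rewrite -!exprM; have -> : (9 * (2 * i + 1) = 3 * (6 * i + 3))%N by lia.
  have -> : (9 * (2 * i + 2) = 3 * (6 * i + 6))%N by lia.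
  rewrite -!/(xsub _) -!/(u i _) /A.
  transitivity ((u i 1%N * g i 1%N) ^+ 2 * (u i 2%N * g i 2%N) ^+ 2 * (u i 4%N * g i 4%N) ^+ 2
     * (u i 5%N * g i 5%N) ^+ 2 * (u i 6%N * g i 6%N) * (u i 3%N ^+ 2 * u i 6%N)); first ring.
  by rewrite !ug !expr1n !mul1r.
have th1 : eqm N (theta (- q ^+ 15) (- q ^+ 3) n) (\prod_(i < n) B i * euler 3 ^+ 2).
  have Q : - q ^+ 15 * - q ^+ 3 = q ^+ 18 by ring.
  have Q0 : eqm 1 (- q ^+ 15 * - q ^+ 3) 0 by rewrite Q; apply: eqm1_qn.
  apply: eqm_trans (triple_product _ _ _ _ _ Q0 leNn leNn) _.
  apply: eqm_sym; apply: eqm_trans (eqmM eqm_refl (eqmX _ _ _ 2 E3)) _.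
  rewrite qpoch_x6 -prodrXl /qpoch /theta_prod -!big_split; apply: eqm_prod => i /=.
  rewrite Q -!exprM !mulNr -!exprD.
  have -> : (18 * i.+1 = 3 * (6 * i + 6))%N by lia.
  have -> : (15 + 18 * i = 3 * (6 * i + 5))%N by lia.
  have -> : (3 + 18 * i = 3 * (6 * i + 1))%N by lia.
  rewrite -!/(xsub _) -!/(u i _) /B.
  transitivity ((u i 1%N * g i 1%N) * (u i 5%N * g i 5%N) * (u i 6%N * g i 6%N)
     * (u i 2%N * g i 2%N) ^+ 2 * (u i 3%N * g i 3%N) ^+ 2
     * (u i 4%N * g i 4%N) ^+ 2 * (u i 6%N * (u i 5%N * u i 1%N))); first ring.
  by rewrite !ug !expr1n !mul1r.
move: (eqmD (eqmD th0 (eqmM (@eqm_refl N (- q)) th1)) (eqmM (@eqm_refl N (- q)) th1)).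
move/eqm_trans; apply; set X := \prod_(i < n) A i; set Y := \prod_(i < n) B i.
suff -> : X * euler 3 ^+ 2 + - q * (Y * euler 3 ^+ 2) + - q * (Y * euler 3 ^+ 2) =
  (X - q * (Y *+ 2)) * euler 3 ^+ 2 by [].
ring.
Qed.

(** * The quotient f_1 f_4 / f_2 *)

Lemma prod_pairs (F : nat -> fps) n :
  \prod_(j < n * 2) F j = \prod_(i < n) (F (2 * i)%N * F (2 * i).+1).
Proof.
elim: n => [|n IHn]; first by rewrite !big_ord0.
rewrite mulSn add2n !big_ord_recr /= IHn mulrA.
by have -> : (n * 2 = 2 * n)%N by lia.
Qed.

(** A truncation of psi(-z), where psi(z) is the sum of z^(k(k+1)/2) over k >= 0. Factors are paired
    because the base -z alternates in sign. *)
Definition psi_prod z n : fps :=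
  \prod_(i < n) ((1 + z ^+ (2 * i + 1)) * (1 - z ^+ (2 * i + 1)) ^+ 2
                 * ((1 + z ^+ (2 * i + 2)) ^+ 2 * (1 - z ^+ (2 * i + 2)))).

Lemma theta_psi z N n m : eqm 1 z 0 -> (N <= n)%N -> (N <= m)%N ->
  eqm N (theta (- z) 1 m) (psi_prod z n *+ 2).
Proof.
move=> z0 leNn leNm; have Q0 : eqm 1 (- z * 1) 0.
  by apply/eqm10; rewrite mulr1 fcoefN (z0 0%N) ?oppr0.
have leNn2 : (N <= n * 2)%N by lia.
apply: eqm_trans (triple_product _ _ _ _ _ Q0 leNn2 leNm) _.
rewrite /theta_prod big_split mulr1 /=; rewrite mulr1 in Q0.
pose P := \prod_(j < n * 2) (1 + (- z) ^+ j.+1).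
(* The factor j = 0 equals 2; the factor gained at the other end is 1 modulo [q ^+ N]. *)
have shift : eqm N (\prod_(j < n * 2) (1 + 1 * (- z) ^+ j)) (P *+ 2).
  have E : P *+ 2 = \prod_(j < n * 2) (1 + (- z) ^+ j) * (1 + (- z) ^+ (n * 2)).
    transitivity (\prod_(j < (n * 2).+1) (1 + (- z) ^+ j)); last exact: big_ord_recr.
    by rewrite -mulr_natl big_ord_recl expr0.
  rewrite E -[X in eqm _ X]mulr1; apply: eqmM; first by apply: eqm_prod => i; rewrite mul1r.
  apply/eqm_sym/(eqm_le (n * 2)) => //.
  by rewrite -[X in eqm _ _ X]addr0; apply: eqmD => //; apply: eqm0_expr.
apply: eqm_trans (eqmM eqm_refl (eqmM eqm_refl shift)) _; rewrite !mulrnAr.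
suff -> : qpoch (- z) (n * 2) * (\prod_(j < n * 2) (1 + - z * (- z) ^+ j) * P) = psi_prod z n.
  by [].
rewrite /qpoch /P -!big_split (prod_pairs (fun j => (1 - (- z) ^+ j.+1)
  * ((1 + - z * (- z) ^+ j) * (1 + (- z) ^+ j.+1)))) /psi_prod.
apply: eq_bigr => i _.
have W : (- z) ^+ (2 * i) = z ^+ (2 * i) by rewrite !exprM sqrrN.
by rewrite addn1 addn2 !(exprS (- z)) W !(exprS z); set w := z ^+ (2 * i); ring.
Qed.

Lemma psi_euler N n : (N <= n)%N ->
  eqm N (euler 1 * euler 4) (euler 2 * psi_prod q n).
Proof.
move=> leNn.
have E1 : eqm N (euler 1) (qpoch (q ^+ 1) (n * 2)) by apply: eqm_euler; lia.
have E2 : eqm N (euler 2) (qpoch (q ^+ 2) n) by apply: eqm_euler; lia.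
have E2' : eqm N (euler 2) (qpoch (q ^+ 2) (n * 2)) by apply: eqm_euler; lia.
have E4 : eqm N (euler 4) (qpoch (q ^+ 4) n) by apply: eqm_euler; lia.
(* [G] truncates f_1 f_4 / f_2. Truncating f_2 at both n and 2n makes the identities [G2] and [G4]
   exact. *)
pose G := \prod_(i < n) ((1 - q ^+ (2 * i + 1)) * (1 + q ^+ (2 * i + 2)) * (1 - q ^+ (2 * i + 2))).
have G2 : qpoch (q ^+ 2) (n * 2) * G = qpoch (q ^+ 2) n * psi_prod q n.
  rewrite qpoch2 /qpoch /psi_prod /G -!big_split; apply: eq_bigr => i _ /=.
  rewrite -!exprM; have -> : (2 * i.+1 = 2 * i + 2)%N by lia.
  rewrite ![(2 * (_ + _))%N]mulnC !exprM.
  set u := q ^+ _; set v := q ^+ _; ring.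
have G4 : qpoch (q ^+ 2) n * G = qpoch (q ^+ 1) (n * 2) * qpoch (q ^+ 4) n.
  rewrite qpoch2 /qpoch /G -!big_split; apply: eq_bigr => i _ /=.
  rewrite expr1 -!exprM; have -> : (2 * i.+1 = 2 * i + 2)%N by lia.
  have -> : (4 * i.+1 = (2 * i + 2) * 2)%N by lia.
  rewrite !exprM; set u := q ^+ _; set v := q ^+ _; ring.
apply: eqm_sym; apply: eqm_trans (eqmM E2 eqm_refl) _; rewrite -G2.
apply: eqm_trans (eqmM (eqm_trans (eqm_sym E2') E2) eqm_refl) _; rewrite G4.
exact: eqm_sym (eqmM E1 E4).
Qed.

(** With b = 1 the first and third parts of the dissection coincide, and the middle one is 2
    psi(-q^9). Numerators 1 - x^k cancel as for [phi_split]; those left are 1 + x^k. *)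
Lemma psi_split N : exists A B, [/\ pos3 A, pos3 B
  & eqm N ((euler 1 * euler 4 * (euler 2)^-1) *+ 2) ((A - q * B) * euler 3 ^+ 2)].
Proof.
pose u i r := xsub (6 * i + r); pose g i r := xgeo (6 * i + r); pose v i r := xadd (6 * i + r).
have ug i r : u i r.+1 * g i r.+1 = 1 by apply: xsubK; lia.
pose A i := g i 1%N * g i 5%N * g i 6%N * g i 2%N ^+ 2 * g i 3%N ^+ 2 * g i 4%N ^+ 2
            * v i 2%N * v i 3%N * v i 4%N.
pose B i := g i 1%N ^+ 2 * g i 2%N ^+ 2 * g i 4%N ^+ 2 * g i 5%N ^+ 2 * g i 6%N
            * v i 3%N * v i 6%N ^+ 2.
have g1 i r : nneg3_1 (g i r) by apply: nneg3_1_xgeo.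
have v1 i r : nneg3_1 (v i r.+1) by apply: nneg3_1_xadd; lia.
pose n := N.+1; have leNn : (N <= n)%N by [].
exists ((\prod_(i < n) A i) *+ 2), ((\prod_(i < n) B i) *+ 2); split.
- apply/pos3MrnS/pos3_prod => [|i]; last first.
    by do 8!(apply: nneg3_1M; last by [exact: nneg3_1X|]).
  by do 8!(apply: pos3M; last by [exact: nneg3_1X|]); apply: pos3_xgeo1.
- apply/pos3MrnS/pos3_prod => [|i]; last first.
    by do 6!(apply: nneg3_1M; last by [exact: nneg3_1X|]); apply: nneg3_1X.
  do 6!(apply: pos3M; last by [exact: nneg3_1X|]).
  by rewrite expr2; apply: pos3M => //; apply: pos3_xgeo1.
have theta_euler :
    eqm N ((euler 1 * euler 4 * (euler 2)^-1) *+ 2) (theta (- q) 1 (3 * n).+1).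
  apply: eqmMI (euler_unit 2) _; rewrite mulrnAr mulrCA divrr ?euler_unit // mulr1 -mulr_natr.
  apply: eqm_trans (eqmM (psi_euler _ _ leNn) eqm_refl) _.
  rewrite -mulrA mulr_natr; apply: eqmM => //; apply: eqm_sym; apply: theta_psi => //; last lia.
  exact: (eqm1_qn 1).
apply: eqm_trans theta_euler _; rewrite theta_dissection !expr1n !mulr1 mul1r.
have -> : (- q) ^+ 3 = - q ^+ 3 by ring.
have -> : (- q) ^+ 6 = q ^+ 6 by ring.
have -> : (- q) ^+ 9 = - q ^+ 9 by ring.
rewrite [theta (q ^+ 6) _ _]theta_sym.
have E3 : eqm N (euler 3) _ := euler3_x6 _ _ leNn.
have th0 : eqm N (theta (- q ^+ 3) (q ^+ 6) n) (\prod_(i < n) A i * euler 3 ^+ 2).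
  have Q : - q ^+ 3 * q ^+ 6 = - q ^+ 9 by ring.
  have Q0 : eqm 1 (- q ^+ 3 * q ^+ 6) 0.
    by apply/eqm10; rewrite Q fcoefN fcoef_qn.
  have leNn2 : (N <= n * 2)%N by lia.
  apply: eqm_trans (triple_product _ _ _ _ _ Q0 leNn2 leNn) _.
  apply: eqm_sym; apply: eqm_trans (eqmM eqm_refl (eqmX _ _ _ 2 E3)) _.
  (* The base -q^9 alternates in sign, so two consecutive factors form one block of period q^18. *)
  rewrite qpoch_x6 -prodrXl /qpoch /theta_prod Q -!big_split
    (prod_pairs (fun j => (1 - (- q ^+ 9) ^+ j.+1)
       * ((1 + - q ^+ 3 * (- q ^+ 9) ^+ j) * (1 + q ^+ 6 * (- q ^+ 9) ^+ j)))).
  apply: eqm_prod => i /=.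
  have W : (- q ^+ 9) ^+ (2 * i) = q ^+ (18 * i).
    by rewrite exprM sqrrN -!exprM; congr (q ^+ _); lia.
  rewrite !(exprS (- q ^+ 9)) W.
  have Eu r : u i r = 1 - q ^+ (3 * r) * q ^+ (18 * i).
    by rewrite /u /xsub -exprD; congr (1 - q ^+ _); lia.
  have Ev r : v i r = 1 + q ^+ (3 * r) * q ^+ (18 * i).
    by rewrite /v /xadd -exprD; congr (1 + q ^+ _); lia.
  transitivity (v i 3%N * u i 6%N * (u i 1%N * v i 2%N * v i 4%N * u i 5%N)); last first.
    rewrite !Eu !Ev; set w := q ^+ (18 * i); ring.
  rewrite -!/(u i _) /A.
  transitivity ((u i 1%N * g i 1%N) * (u i 5%N * g i 5%N) * (u i 6%N * g i 6%N)
     * (u i 2%N * g i 2%N) ^+ 2 * (u i 3%N * g i 3%N) ^+ 2 * (u i 4%N * g i 4%N) ^+ 2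
     * (v i 3%N * u i 6%N * (u i 1%N * v i 2%N * v i 4%N * u i 5%N))); first ring.
  by rewrite !ug !expr1n !mul1r.
have th1 : eqm N (theta (- q ^+ 9) 1 n) ((\prod_(i < n) B i * euler 3 ^+ 2) *+ 2).
  apply: eqm_trans (theta_psi _ _ _ _ (eqm1_qn 9 isT) leNn leNn) _.
  rewrite -[psi_prod _ _ *+ 2]mulr_natr -[_ * _ *+ 2]mulr_natr; apply: eqmM => //.
  apply: eqm_sym; apply: eqm_trans (eqmM eqm_refl (eqmX _ _ _ 2 E3)) _.
  rewrite qpoch_x6 -prodrXl /psi_prod -!big_split; apply: eqm_prod => i /=.
  rewrite -!exprM; have -> : (9 * (2 * i + 1) = 3 * (6 * i + 3))%N by lia.
  have -> : (9 * (2 * i + 2) = 3 * (6 * i + 6))%N by lia.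
  rewrite -!/(xsub _) -!/(xadd _) -!/(u i _) -!/(v i _) /B.
  transitivity ((u i 1%N * g i 1%N) ^+ 2 * (u i 2%N * g i 2%N) ^+ 2 * (u i 4%N * g i 4%N) ^+ 2
     * (u i 5%N * g i 5%N) ^+ 2 * (u i 6%N * g i 6%N)
     * (v i 3%N * u i 3%N ^+ 2 * (v i 6%N ^+ 2 * u i 6%N))); first ring.
  by rewrite !ug !expr1n !mul1r.
move: (eqmD (eqmD th0 (eqmM (@eqm_refl N (- q)) th1)) th0).
move/eqm_trans; apply; set X := \prod_(i < n) A i; set Y := \prod_(i < n) B i.
suff -> : X * euler 3 ^+ 2 + - q * ((Y * euler 3 ^+ 2) *+ 2) + X * euler 3 ^+ 2 =
  (X *+ 2 - q * (Y *+ 2)) * euler 3 ^+ 2 by [].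
ring.
Qed.

(** * The cube of f_1 *)

Lemma theta_prod_N1 z n : theta_prod (- z) (- 1) n.+1 = 0.
Proof. by rewrite /theta_prod big_ord_recl expr0 !mulr1 subrr mulr0 mul0r. Qed.

(** The factor 1 + b is 0 at b = -1, so only the term that differentiates it survives. *)
Lemma theta_prod_deriv_N1 z n :
  theta_prod_deriv (- z) (- 1) n.+1 = qpoch z n.+1 * qpoch z n.
Proof.
elim: n => [|n IHn].
  by rewrite /= mul0r add0r qpochS qpoch0 /theta_prod big_ord0 expr0 expr1; ring.
have E m : theta_prod_deriv (- z) (- 1) m.+1 =
    theta_prod_deriv (- z) (- 1) m
      * ((1 + - z * (- z * - 1) ^+ m) * (1 + - 1 * (- z * - 1) ^+ m))
    + theta_prod (- z) (- 1) m * ((- z - - 1) * (- z * - 1) ^+ m) by [].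
rewrite E IHn theta_prod_N1 mul0r addr0 mulrNN mulr1 !qpochS !mulNr -exprS mul1r.
by set u := 1 - _; set v := 1 - _; ring.
Qed.

Lemma theta_N1 z N m : eqm 1 z 0 -> (N <= m)%N -> eqm N (theta (- z) (- 1) m) 0.
Proof.
move=> z0 leNm; have Q0 : eqm 1 (- z * - 1) 0 by rewrite mulrNN mulr1.
have := triple_product _ _ _ _ _ Q0 (leqnSn N) leNm.
by rewrite theta_prod_N1 mulr0.
Qed.

(** Jacobi's identity for the cube of (z; z). *)
Lemma dtheta_N1 z N n m : eqm 1 z 0 -> (N <= n)%N -> (N <= m)%N ->
  eqm N (dtheta (- z) (- 1) m) (qpoch z n ^+ 3).
Proof.
move=> z0 leNn leNm; have Q0 : eqm 1 (- z * - 1) 0 by rewrite mulrNN mulr1.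
apply: eqm_trans (triple_product_deriv _ _ _ _ _ Q0 (leqW leNn) leNm) _.
rewrite theta_prod_deriv_N1 mulrNN mulr1 mulrA.
have E : eqm N (qpoch z n.+1) (qpoch z n).
  by apply: (eqm_le n.+1); [apply: leqW | apply: qpoch_eqm].
have -> : qpoch z n ^+ 3 = qpoch z n * qpoch z n * qpoch z n by ring.
by apply: eqmM => //; apply: eqmM.
Qed.

Lemma qpoch_x3 n : qpoch (q ^+ 3) (n * 3) =
  \prod_(i < n) (xsub (3 * i + 1) * xsub (3 * i + 2) * xsub (3 * i + 3)).
Proof.
rewrite qpochM; apply: eq_bigr => i _; rewrite !big_ord_recl big_ord0 mulr1 /= !mulrA.
by congr (_ * _ * _); rewrite /xsub -exprM /bump; congr (1 - _ ^+ _); lia.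
Qed.

(** Grouping shifted by one, so that 3i + 2 meets 3i + 4 in the factors [C i] of [cube_split]. *)
Lemma qpoch_x3S n : qpoch (q ^+ 3) (n * 3).+1 =
  xsub 1 * \prod_(i < n) (xsub (3 * i + 2) * xsub (3 * i + 3) * xsub (3 * i + 4)).
Proof.
elim: n => [|n IHn]; first by rewrite mul0n qpochS qpoch0 big_ord0 mul1r mulr1.
rewrite mulSn addnC addn3 3!qpochS IHn big_ord_recr /= /xsub -!exprM -!mulrA.
do 2!congr (_ * _).
by congr (_ * (_ * _)); congr (1 - _ ^+ _); lia.
Qed.

Definition lambert n : fps :=
  \sum_(j < n) (1 - q ^+ 3) * (q ^+ (3 * (3 * j + 1)) * (xgeo (3 * j + 1) * xgeo (3 * j + 2))).

Lemma theta_prod_x n : theta_prod (- q ^+ 6) (- q ^+ 3) n =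
  \prod_(i < n) (xsub (3 * i + 1) * xsub (3 * i + 2)).
Proof.
rewrite /theta_prod; apply: eq_bigr => i _.
have -> : - q ^+ 6 * - q ^+ 3 = q ^+ 9 by ring.
rewrite !mulNr -!exprM -!exprD mulrC.
by congr ((1 - _ ^+ _) * (1 - _ ^+ _)); lia.
Qed.

(** [lambert] is the logarithmic derivative: at a = -x^2, b = -x the j-th pair of factors has
    derivative (a - b) x^(3j) = x^(3j+1) (1 - x). *)
Lemma theta_prod_deriv_x n : theta_prod_deriv (- q ^+ 6) (- q ^+ 3) n =
  theta_prod (- q ^+ 6) (- q ^+ 3) n * lambert n.
Proof.
elim: n => [|n IHn]; first by rewrite /lambert big_ord0 mulr0.
have E m : theta_prod_deriv (- q ^+ 6) (- q ^+ 3) m.+1 =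
    theta_prod_deriv (- q ^+ 6) (- q ^+ 3) m
      * ((1 + - q ^+ 6 * (- q ^+ 6 * - q ^+ 3) ^+ m)
         * (1 + - q ^+ 3 * (- q ^+ 6 * - q ^+ 3) ^+ m))
    + theta_prod (- q ^+ 6) (- q ^+ 3) m
      * ((- q ^+ 6 - - q ^+ 3) * (- q ^+ 6 * - q ^+ 3) ^+ m) by [].
rewrite E IHn mulrAC -theta_prodS /lambert big_ord_recr /= mulrDr; congr (_ + _).
rewrite !theta_prod_x big_ord_recr /= -mulrA; congr (_ * _).
have -> : - q ^+ 6 * - q ^+ 3 = q ^+ 9 by ring.
set u := xsub _; set v := xsub _; set g := xgeo _; set h := xgeo _; set w := q ^+ (3 * _).
transitivity ((u * g) * (v * h) * ((1 - q ^+ 3) * w)); last ring.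
rewrite !xsubK ?mul1r; try lia.
have -> : w = q ^+ 3 * q ^+ 9 ^+ n by rewrite -exprM -exprD /w; congr (q ^+ _); lia.
ring.
Qed.

(** By antisymmetry of [dtheta] the outer parts add up to [theta] times 1 + 6 L, where [theta] is
    f_3 by the pentagonal number theorem; the middle part is 3 f_9^3. Hence A = (1 + 6 L) / f_3 and
    B = 3 f_9^3 / f_3^2. *)
Lemma cube_split N : exists A B, [/\ pos3 A, pos3 B
  & eqm N (euler 1 ^+ 3) ((A - q * B) * euler 3 ^+ 2)].
Proof.
pose n := N.+1; have leNn : (N <= n)%N by [].
pose U i := xsub (3 * i + 1) * xsub (3 * i + 2) * xsub (3 * i + 3).
pose G i := xgeo (3 * i + 1) * xgeo (3 * i + 2) * xgeo (3 * i + 3).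
pose R := \prod_(i < n) G i.
(* Two of the three f_9 cancel in f_3^2. The third supplies the numerators 1 - x^(6i+3) and 1 -
   x^(6i+6), each splitting as the sum of two remaining denominator exponents. *)
pose C i := xsub (3 * i + 1 + (3 * i + 2)) * xgeo (3 * i + 1) * xgeo (3 * i + 2)
            * (xsub (3 * i + 2 + (3 * i + 4)) * xgeo (3 * i + 2) * xgeo (3 * i + 4)).
pose X := xgeo 1 * \prod_(i < n) C i.
have UG i : U i * G i = 1.
  transitivity (xsub (3 * i + 1) * xgeo (3 * i + 1) * (xsub (3 * i + 2) * xgeo (3 * i + 2))
    * (xsub (3 * i + 3) * xgeo (3 * i + 3))); first by rewrite /U /G; ring.
  by rewrite !xsubK ?mul1r //; lia.
have G1 i : nneg3_1 (G i) by do !apply: nneg3_1M; apply: nneg3_1_xgeo.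
have C1 i : nneg3_1 (C i) by apply: nneg3_1M; apply: nneg3_1_xsub_xgeo; lia.
have Rpos : pos3 R.
  by apply: pos3_prod => //; do 2!(apply: pos3M; last exact: nneg3_1_xgeo); apply: pos3_xgeo1.
have Xpos : pos3 X by apply: pos3M; [exact: pos3_xgeo1 | exact: nneg3_1_prod].
have LR : nneg3 (lambert n * R).
  (* The factor 1 - x of each term of [lambert] removes [xgeo 1] from [R]. *)
  have [S [S1 RS]] : exists S, nneg3_1 S /\ (1 - q ^+ 3) * R = S.
    exists (xgeo 2 * xgeo 3 * \prod_(i < N) G i.+1); split.
      apply: nneg3_1M; last by apply: nneg3_1_prod.
      by apply: nneg3_1M; apply: nneg3_1_xgeo.
    rewrite /R big_ord_recl /G !mulrA -[1 - _]/(xsub 1) xsubK // mul1r.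
    by congr (_ * _).
  rewrite /lambert mulr_suml; apply: nneg3_sum => j.
  rewrite -mulrA mulrCA RS; apply: nneg3M; last exact: S1.1.
  by apply: nneg3M; [exact: nneg3_qn | apply: nneg3M; apply: (nneg3_1_xgeo _).1].
exists (R + (lambert n * R) *+ 6), (X *+ 3); split.
- by rewrite !mulrS; do !apply: pos3D => //; do !apply: nneg3D => //; rewrite mulr0n.
- exact: pos3MrnS.
have E1 : eqm N (euler 1) (qpoch (q ^+ 1) n) by apply: eqm_euler.
apply: eqm_trans (eqmX _ _ _ 3 E1) _; rewrite expr1.
have q0 : eqm 1 q 0 := eqm1_qn 1 isT.
have leNm : (N <= (3 * n).+1)%N by lia.
apply: eqm_trans (eqm_sym (dtheta_N1 _ _ _ _ q0 leNn leNm)) _.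
rewrite dtheta_dissection.
have -> : (- q) ^+ 6 * (- 1) ^+ 3 = - q ^+ 6 by ring.
have -> : (- q) ^+ 3 * (- 1) ^+ 6 = - q ^+ 3 by ring.
have -> : (- q) ^+ 9 * (- 1) ^+ 6 = - q ^+ 9 by ring.
have -> : (- q) ^+ 6 * (- 1) ^+ 9 = - q ^+ 6 by ring.
have -> : (- 1) ^+ 3 = - 1 :> fps by ring.
have -> : (- q) ^+ 3 = - q ^+ 3 by ring.
rewrite [dtheta (- q ^+ 3) _ _]dtheta_anti [theta (- q ^+ 3) _ _]theta_sym.
have Q : - q ^+ 6 * - q ^+ 3 = q ^+ 9 by ring.
have Q0 : eqm 1 (- q ^+ 6 * - q ^+ 3) 0 by rewrite Q; apply: eqm1_qn.
have E3 : eqm N (euler 3) (qpoch (q ^+ 3) (n * 3)) by apply: eqm_euler; lia.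
have E3' : eqm N (euler 3) (qpoch (q ^+ 3) (n * 3).+1) by apply: eqm_euler; lia.
have PU : qpoch (q ^+ 9) n * theta_prod (- q ^+ 6) (- q ^+ 3) n = \prod_(i < n) U i.
  rewrite theta_prod_x /qpoch -big_split; apply: eq_bigr => i _ /=; rewrite mulrC -exprM.
  by congr (_ * (1 - _ ^+ _)); lia.
have RE : eqm N (\prod_(i < n) U i) (R * euler 3 ^+ 2).
  apply: eqm_sym; apply: eqm_trans (eqmM eqm_refl (eqmX _ _ _ 2 E3)) _.
  rewrite qpoch_x3 -prodrXl /R -big_split; apply: eqm_prod => i.
  by rewrite /= -/(U i) expr2 mulrA [G i * _]mulrC UG mul1r.
have th : eqm N (theta (- q ^+ 6) (- q ^+ 3) n) (R * euler 3 ^+ 2).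
  by apply: eqm_trans (triple_product _ _ _ _ _ Q0 leNn leNn) _; rewrite Q PU.
have dth : eqm N (dtheta (- q ^+ 6) (- q ^+ 3) n) (R * euler 3 ^+ 2 * lambert n).
  apply: eqm_trans (triple_product_deriv _ _ _ _ _ Q0 leNn leNn) _.
  by rewrite Q theta_prod_deriv_x mulrA PU; apply: eqmM.
have q90 : eqm 1 (q ^+ 9) 0 := eqm1_qn 9 isT.
have dth9 : eqm N (dtheta (- q ^+ 9) (- 1) n) (X * euler 3 ^+ 2).
  apply: eqm_trans (dtheta_N1 _ _ _ _ q90 leNn leNn) _.
  apply: eqm_sym; apply: eqm_trans (eqmM eqm_refl (eqmM E3 E3')) _.
  (* One f_9 is taken with 2n factors because each [C i] uses two of its numerators. *)
  have E9 : eqm N (qpoch (q ^+ 9) (n * 2)) (qpoch (q ^+ 9) n).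
    by apply: (eqm_le n.+1); [lia | apply: qpoch_eqm => //; lia].
  apply: eqm_trans (eqmM E9 (@eqm_refl N (qpoch (q ^+ 9) n ^+ 2))).
  rewrite qpoch_x3 qpoch_x3S qpoch2 /X.
  suff -> : xgeo 1 * \prod_(i < n) C i * (\prod_(i < n) U i * (xsub 1
      * \prod_(i < n) (xsub (3 * i + 2) * xsub (3 * i + 3) * xsub (3 * i + 4)))) =
    \prod_(i < n) ((1 - q ^+ 9 ^+ (2 * i + 1)) * (1 - q ^+ 9 ^+ (2 * i + 2)))
      * qpoch (q ^+ 9) n ^+ 2 by [].
  set W := \prod_(i < n) (xsub (3 * i + 2) * _ * _).
  transitivity (xsub 1 * xgeo 1 * (\prod_(i < n) C i * (\prod_(i < n) U i * W))); first ring.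
  rewrite xsubK // mul1r /W /qpoch -prodrXl -!big_split; apply: eq_bigr => i _ /=.
  rewrite -!exprM; have -> : (9 * i.+1 = 3 * (3 * i + 3))%N by lia.
  have -> : (9 * (2 * i + 1) = 3 * (3 * i + 1 + (3 * i + 2)))%N by lia.
  have -> : (9 * (2 * i + 2) = 3 * (3 * i + 2 + (3 * i + 4)))%N by lia.
  rewrite -!/(xsub _) /C /U.
  transitivity (xsub (3 * i + 1) * xgeo (3 * i + 1) * (xsub (3 * i + 2) * xgeo (3 * i + 2)) ^+ 2
     * (xsub (3 * i + 4) * xgeo (3 * i + 4))
     * (xsub (3 * i + 1 + (3 * i + 2)) * xsub (3 * i + 2 + (3 * i + 4)) * xsub (3 * i + 3) ^+ 2)).
    ring.
  by rewrite !xsubK ?expr1n ?mul1r //; lia.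
have th9 : eqm N (theta (- q ^+ 9) (- 1) n) 0 by apply: theta_N1.
move: (eqmD (eqmD (eqmM (@eqm_refl N 3) dth)
  (eqmM (@eqm_refl N (- q)) (eqmD (eqmM (@eqm_refl N 3) dth9) th9)))
  (eqmM (@eqm_refl N (- 1)) (eqmD (eqmM (@eqm_refl N 3) (eqmN _ _ _ dth)) (eqmN _ _ _ th)))).
move/eqm_trans; apply; set L := lambert n; set E := euler 3.
suff -> : 3 * (R * E ^+ 2 * L) + - q * (3 * (X * E ^+ 2) + 0)
    + - 1 * (3 * - (R * E ^+ 2 * L) - R * E ^+ 2) =
  (R + (L * R) *+ 6 - q * (X *+ 3)) * E ^+ 2 by [].
ring.
Qed.

Theorem theorem3p2 (t1 t2 t3 t4 : int) (ht : (t1, t2, t3, t4) \in S3) (n : nat) :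
  [/\ 0 < euler_quot_coef [:: t1; t2; t3; t4] (3 * n)%N,
      euler_quot_coef [:: t1; t2; t3; t4] (3 * n + 1)%N < 0
    & euler_quot_coef [:: t1; t2; t3; t4] (3 * n + 2)%N = 0].
Proof.
have quotE f : \prod_(i < 4) euler i.+1 ^ [:: t1; t2; t3; t4]`_i = f * euler 3 ^- 2 ->
    forall i, euler_quot_coef [:: t1; t2; t3; t4] i = fcoef (f * euler 3 ^- 2) i.
  by move=> E i; rewrite /euler_quot_coef E.
have prod4 : \prod_(i < 4) euler i.+1 ^ [:: t1; t2; t3; t4]`_i =
    euler 1 ^ t1 * euler 2 ^ t2 * euler 3 ^ t3 * euler 4 ^ t4.
  by rewrite !big_ord_recl big_ord0 mulr1 !mulrA.
move: ht; rewrite !inE => /or3P[] /eqP[E1 E2 E3 E4].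
- have E : euler 1 ^ t1 * euler 2 ^ t2 * euler 3 ^ t3 * euler 4 ^ t4 = euler 1 ^+ 3 * euler 3 ^- 2.
    by rewrite E1 E2 E3 E4 !expr0z !mulr1.
  rewrite !(quotE _ (etrans prod4 E)); apply: (sign_pattern_div _ 0) => N.
  exact: cube_split.
- have E : euler 1 ^ t1 * euler 2 ^ t2 * euler 3 ^ t3 * euler 4 ^ t4 =
      euler 1 * euler 4 * (euler 2)^-1 * euler 3 ^- 2.
    rewrite E1 E2 E3 E4 !expr1z -[euler 2 ^ _]/((euler 2)^-1) -[euler 3 ^ _]/(euler 3 ^- 2).
    by rewrite -!mulrA; congr (_ * _); rewrite mulrA mulrC.
  rewrite !(quotE _ (etrans prod4 E)); apply: (sign_pattern_div _ 1) => N.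
  exact: psi_split.
have E : euler 1 ^ t1 * euler 2 ^ t2 * euler 3 ^ t3 * euler 4 ^ t4 =
    euler 1 ^+ 2 * (euler 2)^-1 * euler 3 ^- 2.
  by rewrite E1 E2 E3 E4 !expr0z !mulr1.
rewrite !(quotE _ (etrans prod4 E)); apply: (sign_pattern_div _ 0) => N.
exact: phi_split.
Qed.
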